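(* Let $\Gamma\rightrightarrows X$ be a groupoid and let $\theta$ be a partial action of a group $G$ on a set $Y$. Then the partial action groupoid $\Psi(\theta)$ is isomorphic to $\Gamma\rightrightarrows X$ if, and only if, there exists $N\in\mathcal W_\Gamma$ such that $\operatorname{red}\theta$ is isomorphic (as a partial action) to the quotient partial action $\overline{\theta^\Gamma}$ of $\theta^\Gamma$ by $(\mathcal D,N)$, where $\mathcal D$ is the diagonal relation on $X$ (i.e. $x\sim_{\mathcal D}y\Leftrightarrow x=y$).
   Context: Partial action: $\theta=(G,X,\{X_g\},\{\theta_g\})$ of a group $G$ on a set $X$ consists of subsets $X_g\subseteq X$ and bijections $\theta_g:X_{g^{-1}}\to X_g$ such that (i) $X_1=X$, $\theta_1=1_X$; (ii) $\theta_g(X_{g^{-1}}\cap X_{g^{-1}h})\subseteq X_g\cap X_h$; (iii) $\theta_g\theta_h(x)=\theta_{gh}(x)$ for $x\in X_{h^{-1}}\cap X_{h^{-1}g^{-1}}$. A morphism from $(G,X,\{X_g\},\{\alpha_g\})$ to $(S,Y,\{Y_s\},\{\beta_s\})$ is a pair $(\phi_0,\phi_1)$, $\phi_0:X\to Y$ a map, $\phi_1:G\to S$ a group homomorphism, with $\phi_0(X_g)\subseteq Y_{\phi_1(g)}$ and $\phi_0(\alpha_g(x))=\beta_{\phi_1(g)}(\phi_0(x))$ for $x\in X_{g^{-1}}$; isomorphisms are invertible morphisms. Partial action groupoid $\Psi(\theta)$: object set $X$, arrows $(\theta_g(x),g,x)$ with $g\in G$, $x\in X_{g^{-1}}$, source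 $x$, target $\theta_g(x)$, composition $(\theta_g(y),g,y)(\theta_h(x),h,x)=(\theta_{gh}(x),gh,x)$ when $y=\theta_h(x)$. $\operatorname{red}\theta$: let $\operatorname{red}G$ be the subgroup of $G$ generated by $\{g\in G:\theta_g\ne\emptyset\}$ (those $g$ with nonempty domain); $\operatorname{red}\theta$ is the restriction $(\operatorname{red}G,X,\{X_g\}_{g\in\operatorname{red}G},\{\theta_g\}_{g\in\operatorname{red}G})$. For a groupoid $\Gamma\rightrightarrows X$ with source $\operatorname{s}$ and target $\operatorname{t}$ (the product $\alpha\beta$ is defined iff $\operatorname{s}(\alpha)=\operatorname{t}(\beta)$): $G_\Gamma$ is the group generated by symbols $\lceil\gamma\rceil$ ($\gamma\in\Gamma$) with relations $\lceil1_x\rceil=1$ ($x\in X$) and $\lceil\alpha\rceil\lceil\beta\rceil=\lceil\alpha\beta\rceil$ for composable $(\alpha,\beta)$. (Distinct non-identity arrows give distinct non-trivial elements of $G_\Gamma$.) $\theta^\Gamma$ is the partial action of $G_\Gamma$ on $X$ with $X^\Gamma_1=X$, $\theta^\Gamma_1=1_X$; $X^\Gamma_{\lceil\gamma\rceil}=\{\operatorname{t}(\gamma)\}$ and $\theta^\Gamma_{\lceil\gamma\rceil}(\operatorname{s}(\gamma))=\operatorname{t}(\gamma)$ for non-identity $\gamma$; and $X^\Gamma_\omega=\varnothing$ for all other $\omega$. Put $$\mathcal W_\Gamma=\{N\trianglelefteq G_\Gamma:\ g\ne\lceil\gamma\rceil\text{ for all }g\in N\setminus\{1\}\text{ and all }\gamma\in\Gamma\}.$$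 Quotient partial action of $\alpha=(G,X,\{X_g\},\{\alpha_g\})$ by $(\mathcal R,K)$ ($\mathcal R$ an equivalence relation on $X$, $K\trianglelefteq G$): an $\mathcal R$-chain is a tuple $\mathfrak c=((x_1,g_1),\dots,(x_n,g_n))$, $n\ge1$, with $x_i\in X_{g_i}$ and $\alpha_{g_{i-1}^{-1}}(x_{i-1})\sim_{\mathcal R}x_i$ for $1<i\le n$; $\operatorname{t}(\mathfrak c)=x_1$, $\operatorname{s}(\mathfrak c)=\alpha_{g_n^{-1}}(x_n)$, $\epsilon(\mathfrak c)=g_1\cdots g_n$. $(\mathcal R,K)$ is a partial action congruence if for all $\mathcal R$-chains $\mathfrak c,\mathfrak o$ with $\epsilon(\mathfrak c)K=\epsilon(\mathfrak o)K$ one has $\operatorname{s}(\mathfrak c)\sim\operatorname{s}(\mathfrak o)\Leftrightarrow\operatorname{t}(\mathfrak c)\sim\operatorname{t}(\mathfrak o)$. In that case the quotient is the partial action of $G/K$ on $X/\mathcal R$ with $D_{\overline g}=\{\overline{\operatorname{t}(\mathfrak c)}:\overline{\epsilon(\mathfrak c)}=\overline g\}$ and maps $\overline{\operatorname{s}(\mathfrak c)}\mapsto\overline{\operatorname{t}(\mathfrak c)}$ for $\overline{\epsilon(\mathfrak c)}=\overline g$. For $N\in\mathcal W_\Gamma$, $(\mathcal D,N)$ is a partial action congruence on $\theta^\Gamma$. *)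

(* Defs.v *)
From HB Require Import structures.
From mathcomp Require Import all_boot.
From mathcomp Require Import mathcomp_extra boolp classical_sets functions.

Set Implicit Arguments.
Unset Strict Implicit.
Unset Printing Implicit Defensive.

#[local] Obligation Tactic := idtac.

Import Algebra.

Local Open Scope classical_set_scope.
Local Open Scope group_scope.

(** Quotients of types: the type of classes [R x] of a relation [R], which is
    meant to be an equivalence relation. *)

Definition quo (T : Type) (R : T -> T -> Prop) : Type :=
  {A : set T | exists x, A = R x}.

Definition cls (T : Type) (R : T -> T -> Prop) (x : T) : quo R :=
  exist _ (R x : set T) (ex_intro _ x erefl).

Lemma quo_repr_subproof (T : Type) (R : T -> T -> Prop) (a : quo R) :
  exists x, a = cls R x.
Proof. by case: a => A [x Ax]; exists x; apply: eq_exist. Qed.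

Definition quo_repr (T : Type) (R : T -> T -> Prop) (a : quo R) : T :=
  projT1 (cid (quo_repr_subproof a)).

Lemma quo_reprK (T : Type) (R : T -> T -> Prop) (a : quo R) :
  cls R (quo_repr a) = a.
Proof. by rewrite /quo_repr; case: cid. Qed.

Lemma cls_eqP (T : Type) (R : T -> T -> Prop) (x y : T) :
  RelationClasses.Equivalence R -> cls R x = cls R y <-> R x y.
Proof.
case=> Rr Rs Rt; split=> [[/(congr1 (@^~ y)) ->]|Rxy]; first exact: Rr.
apply: eq_exist; apply/funext => z; apply/propext; split => Rz.
  by apply: Rt Rz; apply: Rs.
exact: Rt Rz.
Qed.

Lemma repr_clsP (T : Type) (R : T -> T -> Prop) (x : T) :
  RelationClasses.Equivalence R -> R (quo_repr (cls R x)) x.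
Proof. by move=> eR; apply/(cls_eqP _ _ eR); rewrite quo_reprK. Qed.

HB.instance Definition _ (T : Type) (R : T -> T -> Prop) := gen_eqMixin (quo R).
HB.instance Definition _ (T : Type) (R : T -> T -> Prop) :=
  gen_choiceMixin (quo R).

Record subgroup (G : groupType) := Subgroup {
  subgroup_set :> G -> Prop;
  subgroup1 : subgroup_set 1;
  subgroupM : forall x y, subgroup_set x -> subgroup_set y ->
                          subgroup_set (x * y);
  subgroupV : forall x, subgroup_set x -> subgroup_set x^-1 }.

(** The subgroup generated by [S]: the intersection of the subgroups
    containing [S]. *)
Program Definition gen_subgroup (G : groupType) (S : set G) : subgroup G :=
  @Subgroup G [set g | forall H : subgroup G, S `<=` H -> H g] _ _ _.
Next Obligation. by move=> G S H _; apply: subgroup1. Qed.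
Next Obligation.
by move=> G S x y Sx Sy H SH; apply: subgroupM; [apply: Sx|apply: Sy].
Qed.
Next Obligation. by move=> G S x Sx H SH; apply: subgroupV; apply: Sx. Qed.

(** A subgroup seen as a group. *)
Definition subgroup_type (G : groupType) (H : subgroup G) : Type :=
  {g : G | `[< H g >]}.

HB.instance Definition _ (G : groupType) (H : subgroup G) :=
  SubChoice.on (subgroup_type H).

Lemma subgroup_closed (G : groupType) (H : subgroup G) :
  group_closed [pred g : G | `[< H g >]].
Proof.
split; first by apply/asboolP/subgroup1.
move=> x y /asboolP Hx /asboolP Hy; apply/asboolP.
by apply: subgroupM => //; apply: subgroupV.
Qed.

HB.instance Definition _ (G : groupType) (H : subgroup G) :=
  SubChoice_isSubGroup.Build G [pred g : G | `[< H g >]] (subgroup_type H)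
    (subgroup_closed H).

Record normal_subgroup (G : groupType) := NormalSubgroup {
  normal_subgroup_val :> subgroup G;
  normalJ : forall x g, normal_subgroup_val x -> normal_subgroup_val (x ^ g) }.

(** The quotient group [G / N]; the class of [g] is the left coset [g N]. *)
Definition coset_rel (G : groupType) (N : normal_subgroup G) (x y : G) : Prop :=
  N (x^-1 * y).

Definition quo_group (G : groupType) (N : normal_subgroup G) : Type :=
  quo (coset_rel N).

Definition coset (G : groupType) (N : normal_subgroup G) (g : G) :
  quo_group N := cls (coset_rel N) g.

Lemma coset_equiv (G : groupType) (N : normal_subgroup G) :
  RelationClasses.Equivalence (coset_rel N).
Proof.
split=> [x|x y Nxy|x y z Nxy Nyz]; rewrite /coset_rel.
- by rewrite mulVg; apply: subgroup1.
- by rewrite -[_ * _]invgK invgM invgK; apply: subgroupV.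
- by rewrite -(mulVKg y z) mulgA; apply: subgroupM.
Qed.

Lemma coset_repr (G : groupType) (N : normal_subgroup G) (a : quo_group N) :
  exists g, a = coset N g.
Proof. exact: quo_repr_subproof. Qed.

Definition quo_mul (G : groupType) (N : normal_subgroup G)
  (a b : quo_group N) : quo_group N := coset N (quo_repr a * quo_repr b).
Definition quo_inv (G : groupType) (N : normal_subgroup G)
  (a : quo_group N) : quo_group N := coset N (quo_repr a)^-1.

Lemma coset_eqP (G : groupType) (N : normal_subgroup G) (x y : G) :
  coset N x = coset N y <-> N (x^-1 * y).
Proof. exact: (cls_eqP _ _ (coset_equiv N)). Qed.

Lemma quo_mulE (G : groupType) (N : normal_subgroup G) (x y : G) :
  quo_mul (coset N x) (coset N y) = coset N (x * y).
Proof.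
apply/coset_eqP.
have Nx := repr_clsP x (coset_equiv N); have Ny := repr_clsP y (coset_equiv N).
rewrite -/(coset N x) /coset_rel in Nx; rewrite -/(coset N y) /coset_rel in Ny.
move: (quo_repr (coset N x)) (quo_repr (coset N y)) Nx Ny => x' y' Nx Ny.
have -> : (x' * y')^-1 * (x * y) = (x'^-1 * x) ^ y' * (y'^-1 * y).
  by rewrite /conjg invgM !mulgA mulgK.
by apply: subgroupM => //; apply: normalJ.
Qed.

Lemma quo_invE (G : groupType) (N : normal_subgroup G) (x : G) :
  quo_inv (coset N x) = coset N x^-1.
Proof.
apply/coset_eqP.
have Nx := repr_clsP x (coset_equiv N).
rewrite -/(coset N x) /coset_rel in Nx.
move: (quo_repr (coset N x)) Nx => x' Nx; rewrite invgK.
have -> : x' * x^-1 = ((x'^-1 * x)^-1) ^ x'^-1.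
  by rewrite /conjg invgM !invgK !mulgA mulgK.
by apply: normalJ; apply: subgroupV.
Qed.

Lemma quo_mulA (G : groupType) (N : normal_subgroup G) :
  associative (@quo_mul G N).
Proof.
move=> a b c; have [x ->] := coset_repr a; have [y ->] := coset_repr b.
by have [z ->] := coset_repr c; rewrite !quo_mulE mulgA.
Qed.
Lemma quo_mul1g (G : groupType) (N : normal_subgroup G) :
  left_id (coset N 1) (@quo_mul G N).
Proof. by move=> a; have [x ->] := coset_repr a; rewrite quo_mulE mul1g. Qed.
Lemma quo_mulg1 (G : groupType) (N : normal_subgroup G) :
  right_id (coset N 1) (@quo_mul G N).
Proof. by move=> a; have [x ->] := coset_repr a; rewrite quo_mulE mulg1. Qed.
Lemma quo_mulVg (G : groupType) (N : normal_subgroup G) :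
  left_inverse (coset N 1) (@quo_inv G N) (@quo_mul G N).
Proof.
by move=> a; have [x ->] := coset_repr a; rewrite quo_invE quo_mulE mulVg.
Qed.
Lemma quo_mulgV (G : groupType) (N : normal_subgroup G) :
  right_inverse (coset N 1) (@quo_inv G N) (@quo_mul G N).
Proof.
by move=> a; have [x ->] := coset_repr a; rewrite quo_invE quo_mulE mulgV.
Qed.

HB.instance Definition _ (G : groupType) (N : normal_subgroup G) :=
  Choice.on (quo_group N).
HB.instance Definition _ (G : groupType) (N : normal_subgroup G) :=
  isGroup.Build (quo_group N) (@quo_mulA G N) (@quo_mul1g G N)
    (@quo_mulg1 G N) (@quo_mulVg G N) (@quo_mulgV G N).

Lemma cosetM (G : groupType) (N : normal_subgroup G) (x y : G) :
  coset N (x * y) = coset N x * coset N y.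
Proof. by rewrite -quo_mulE. Qed.
Lemma cosetV (G : groupType) (N : normal_subgroup G) (x : G) :
  coset N x^-1 = (coset N x)^-1.
Proof. by rewrite -quo_invE. Qed.
Lemma coset1 (G : groupType) (N : normal_subgroup G) : coset N 1 = 1.
Proof. by []. Qed.

(** The group presented by generators [S] and relations [u = v] for [r u v].
    A word is a list of letters; [(false, s)] stands for [s] and [(true, s)]
    for the formal inverse of [s]. *)

Definition word (S : Type) : Type := seq (bool * S).

Inductive pres_eqv (S : Type) (r : word S -> word S -> Prop) :
    word S -> word S -> Prop :=
| pres_refl u : pres_eqv r u u
| pres_sym u v : pres_eqv r u v -> pres_eqv r v u
| pres_trans u v w : pres_eqv r u v -> pres_eqv r v w -> pres_eqv r u w
| pres_cat u u' v v' : pres_eqv r u u' -> pres_eqv r v v' ->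
    pres_eqv r (u ++ v) (u' ++ v')
| pres_cancel b s : pres_eqv r [:: (b, s); (~~ b, s)] [::]
| pres_rel u v : r u v -> pres_eqv r u v.

Definition presented (S : Type) (r : word S -> word S -> Prop) : Type :=
  quo (pres_eqv r).

Definition word_inv (S : Type) (u : word S) : word S :=
  rev [seq (~~ l.1, l.2) | l <- u].

Definition pres_class (S : Type) (r : word S -> word S -> Prop) (u : word S) :
  presented r := cls (pres_eqv r) u.

Definition pres_mul (S : Type) (r : word S -> word S -> Prop)
  (a b : presented r) : presented r := pres_class r (quo_repr a ++ quo_repr b).
Definition pres_inv (S : Type) (r : word S -> word S -> Prop)
  (a : presented r) : presented r := pres_class r (word_inv (quo_repr a)).

Lemma pres_equiv (S : Type) (r : word S -> word S -> Prop) :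
  RelationClasses.Equivalence (pres_eqv r).
Proof.
by split=> [x|x y|x y z]; [apply: pres_refl|apply: pres_sym|apply: pres_trans].
Qed.

Lemma pres_classP (S : Type) (r : word S -> word S -> Prop) (u v : word S) :
  pres_class r u = pres_class r v <-> pres_eqv r u v.
Proof. exact: (cls_eqP _ _ (pres_equiv r)). Qed.

Lemma pres_class_repr (S : Type) (r : word S -> word S -> Prop)
  (a : presented r) : exists u, a = pres_class r u.
Proof. exact: quo_repr_subproof. Qed.

Lemma word_invK (S : Type) : involutive (@word_inv S).
Proof.
move=> u; rewrite /word_inv map_rev revK -map_comp -[RHS]map_id.
by apply: eq_map => -[b s] /=; rewrite negbK.
Qed.

Lemma pres_mulV (S : Type) (r : word S -> word S -> Prop) (u : word S) :
  pres_eqv r (u ++ word_inv u) [::].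
Proof.
elim: u => [|[b s] u IH]; first exact: pres_refl.
rewrite /word_inv /= rev_cons -cats1 -/(word_inv u) catA.
apply: (@pres_trans _ _ _ ([:: (b, s)] ++ [::] ++ [:: (~~ b, s)])).
  apply: (@pres_cat _ _ [:: (b, s)]); first exact: pres_refl.
  by apply: pres_cat => //; apply: pres_refl.
exact: pres_cancel.
Qed.

Lemma pres_Vmul (S : Type) (r : word S -> word S -> Prop) (u : word S) :
  pres_eqv r (word_inv u ++ u) [::].
Proof. by rewrite -{2}(word_invK u); apply: pres_mulV. Qed.

Lemma pres_eqvV (S : Type) (r : word S -> word S -> Prop) (u v : word S) :
  pres_eqv r u v -> pres_eqv r (word_inv u) (word_inv v).
Proof.
move=> uv.
apply: (@pres_trans _ _ _ (word_inv u ++ (v ++ word_inv v))).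
  rewrite -{1}[word_inv u]cats0; apply: pres_cat; first exact: pres_refl.
  exact/pres_sym/pres_mulV.
rewrite catA -{2}[word_inv v]cat0s; apply: pres_cat; last exact: pres_refl.
apply: pres_trans (pres_Vmul r u).
by apply: pres_cat; [apply: pres_refl|apply: pres_sym].
Qed.

Lemma pres_mulE (S : Type) (r : word S -> word S -> Prop) (u v : word S) :
  pres_mul (pres_class r u) (pres_class r v) = pres_class r (u ++ v).
Proof.
by apply/pres_classP; apply: pres_cat; apply: repr_clsP; apply: pres_equiv.
Qed.
Lemma pres_invE (S : Type) (r : word S -> word S -> Prop) (u : word S) :
  pres_inv (pres_class r u) = pres_class r (word_inv u).
Proof.
by apply/pres_classP; apply: pres_eqvV; apply: repr_clsP; apply: pres_equiv.
Qed.

Lemma pres_mulA (S : Type) (r : word S -> word S -> Prop) :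
  associative (@pres_mul S r).
Proof.
move=> a b c; have [x ->] := pres_class_repr a.
have [y ->] := pres_class_repr b; have [z ->] := pres_class_repr c.
by rewrite !pres_mulE catA.
Qed.
Lemma pres_mul1g (S : Type) (r : word S -> word S -> Prop) :
  left_id (pres_class r [::]) (@pres_mul S r).
Proof. by move=> a; have [x ->] := pres_class_repr a; rewrite pres_mulE. Qed.
Lemma pres_mulg1 (S : Type) (r : word S -> word S -> Prop) :
  right_id (pres_class r [::]) (@pres_mul S r).
Proof.
by move=> a; have [x ->] := pres_class_repr a; rewrite pres_mulE cats0.
Qed.
Lemma pres_mulVg (S : Type) (r : word S -> word S -> Prop) :
  left_inverse (pres_class r [::]) (@pres_inv S r) (@pres_mul S r).
Proof.
move=> a; have [x ->] := pres_class_repr a; rewrite pres_invE pres_mulE.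
exact/pres_classP/pres_Vmul.
Qed.
Lemma pres_mulgV (S : Type) (r : word S -> word S -> Prop) :
  right_inverse (pres_class r [::]) (@pres_inv S r) (@pres_mul S r).
Proof.
move=> a; have [x ->] := pres_class_repr a; rewrite pres_invE pres_mulE.
exact/pres_classP/pres_mulV.
Qed.

HB.instance Definition _ (S : Type) (r : word S -> word S -> Prop) :=
  Choice.on (presented r).
HB.instance Definition _ (S : Type) (r : word S -> word S -> Prop) :=
  isGroup.Build (presented r) (@pres_mulA S r) (@pres_mul1g S r)
    (@pres_mulg1 S r) (@pres_mulVg S r) (@pres_mulgV S r).

(** Partial actions. [act g] represents the bijection from [dom g^-1] onto
    [dom g]; its values outside [dom g^-1] are meaningless. *)
Record partial_action (G : groupType) (X : Type) := PartialAction {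
  dom : G -> set X;
  act : G -> X -> X;
  act_bij : forall g, set_bij (dom g^-1) (dom g) (act g);
  dom1 : dom 1 = setT;
  act1 : forall x, act 1 x = x;
  act_dom : forall g h,
    act g @` (dom g^-1 `&` dom (g^-1 * h)) `<=` dom g `&` dom h;
  actM : forall g h x, (dom h^-1 `&` dom (h^-1 * g^-1)) x ->
    act g (act h x) = act (g * h) x }.

Definition pa_morphism (G S : groupType) (X Y : Type)
    (a : partial_action G X) (b : partial_action S Y)
    (phi0 : X -> Y) (phi1 : G -> S) : Prop :=
  [/\ monoid_morphism phi1,
      forall g, phi0 @` dom a g `<=` dom b (phi1 g)
    & forall g x, dom a g^-1 x ->
        phi0 (act a g x) = act b (phi1 g) (phi0 x)].

Definition pa_isomorphic (G S : groupType) (X Y : Type)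
    (a : partial_action G X) (b : partial_action S Y) : Prop :=
  exists (phi0 : X -> Y) (phi1 : G -> S) (psi0 : Y -> X) (psi1 : S -> G),
    [/\ pa_morphism a b phi0 phi1, pa_morphism b a psi0 psi1,
        cancel phi0 psi0 /\ cancel psi0 phi0
      & cancel phi1 psi1 /\ cancel psi1 phi1].

Lemma act_domV (G : groupType) (X : Type) (a : partial_action G X) g x :
  dom a g x -> dom a g^-1 (act a g^-1 x).
Proof.
by move=> gx; have [+ _ _] := act_bij a g^-1; rewrite invgK; apply.
Qed.

Lemma act_domL (G : groupType) (X : Type) (a : partial_action G X) g x :
  dom a g^-1 x -> dom a g (act a g x).
Proof. by move=> gx; have [+ _ _] := act_bij a g; apply. Qed.

Lemma actK (G : groupType) (X : Type) (a : partial_action G X) g x :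
  dom a g^-1 x -> act a g^-1 (act a g x) = x.
Proof.
move=> gx; rewrite actM; first by rewrite mulVg act1.
by split=> //; rewrite invgK mulVg dom1.
Qed.

Lemma actVK (G : groupType) (X : Type) (a : partial_action G X) g x :
  dom a g x -> act a g (act a g^-1 x) = x.
Proof. by move=> gx; rewrite -{1}[g]invgK actK // invgK. Qed.

(** [red theta]; [theta_g] is nonempty when its domain [dom theta g^-1] is. *)
Definition red_subgroup (G : groupType) (X : Type) (a : partial_action G X) :
  subgroup G := gen_subgroup [set g | dom a g^-1 !=set0].

Definition red_group (G : groupType) (X : Type) (a : partial_action G X) :
  groupType := subgroup_type (red_subgroup a).

Program Definition red (G : groupType) (X : Type) (a : partial_action G X) :
    partial_action (red_group a) X :=
  @PartialAction (red_group a) X (fun g => dom a (val g))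
    (fun g => act a (val g)) _ _ _ _ _.
Next Obligation. by move=> G X a g; exact: (act_bij a (val g)). Qed.
Next Obligation. by move=> G X a; exact: (dom1 a). Qed.
Next Obligation. by move=> G X a; exact: (act1 a). Qed.
Next Obligation. by move=> G X a g h; exact: (@act_dom _ _ a (val g) (val h)). Qed.
Next Obligation. by move=> G X a g h; exact: (@actM _ _ a (val g) (val h)). Qed.

(** Groupoids over the object set [X]; [comp a b] is the product [a b], defined
    when [src a = tgt b]. *)
Record groupoid (X : Type) := Groupoid {
  arrow :> Type;
  src : arrow -> X;
  tgt : arrow -> X;
  unit_arrow : X -> arrow;
  inv_arrow : arrow -> arrow;
  comp : forall a b : arrow, src a = tgt b -> arrow;
  src_unit : forall x, src (unit_arrow x) = x;
  tgt_unit : forall x, tgt (unit_arrow x) = x;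
  src_inv : forall a, src (inv_arrow a) = tgt a;
  tgt_inv : forall a, tgt (inv_arrow a) = src a;
  src_comp : forall a b (ab : src a = tgt b), src (comp ab) = src b;
  tgt_comp : forall a b (ab : src a = tgt b), tgt (comp ab) = tgt a;
  compA : forall a b c (ab : src a = tgt b) (bc : src b = tgt c)
    (ab_c : src (comp ab) = tgt c) (a_bc : src a = tgt (comp bc)),
    comp ab_c = comp a_bc;
  comp1l : forall a (h : src (unit_arrow (tgt a)) = tgt a), comp h = a;
  comp1r : forall a (h : src a = tgt (unit_arrow (src a))), comp h = a;
  compVl : forall a (h : src (inv_arrow a) = tgt a),
    comp h = unit_arrow (src a);
  compVr : forall a (h : src a = tgt (inv_arrow a)),
    comp h = unit_arrow (tgt a) }.

Definition groupoid_morphism (X Y : Type) (C : groupoid X) (D : groupoid Y)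
    (f0 : X -> Y) (f1 : C -> D) : Prop :=
  [/\ forall a, src (f1 a) = f0 (src a),
      forall a, tgt (f1 a) = f0 (tgt a),
      forall x, f1 (unit_arrow C x) = unit_arrow D (f0 x)
    & forall (a b : C) (ab : src a = tgt b) (fab : src (f1 a) = tgt (f1 b)),
        f1 (comp ab) = comp fab].

Definition groupoid_isomorphic (X Y : Type) (C : groupoid X) (D : groupoid Y) :
    Prop :=
  exists (f0 : X -> Y) (f1 : C -> D) (k0 : Y -> X) (k1 : D -> C),
    [/\ groupoid_morphism f0 f1, groupoid_morphism k0 k1,
        cancel f0 k0 /\ cancel k0 f0 & cancel f1 k1 /\ cancel k1 f1].

(** The partial action groupoid. The arrow [(theta_g x, g, x)] is determined by
    [g] and [x], so its first component is not stored. *)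
Record pa_arrow (G : groupType) (X : Type) (a : partial_action G X) := PaArrow {
  pa_elt : G;
  pa_src : X;
  pa_srcP : dom a pa_elt^-1 pa_src }.

Definition pa_tgt (G : groupType) (X : Type) (a : partial_action G X)
  (p : pa_arrow a) : X := act a (pa_elt p) (pa_src p).

Lemma pa_arrow_eq (G : groupType) (X : Type) (a : partial_action G X)
  (p q : pa_arrow a) : pa_elt p = pa_elt q -> pa_src p = pa_src q -> p = q.
Proof.
case: p q => [g x gx] [h y hy] /= gh xy; subst h y.
by congr PaArrow; apply: Prop_irrelevance.
Qed.

Lemma pa_unit_subproof (G : groupType) (X : Type) (a : partial_action G X) x :
  dom a 1^-1 x.
Proof. by rewrite invg1 dom1. Qed.

Lemma pa_inv_subproof (G : groupType) (X : Type) (a : partial_action G X)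
  (p : pa_arrow a) : dom a (pa_elt p)^-1^-1 (pa_tgt p).
Proof. by rewrite invgK; apply: act_domL; apply: pa_srcP. Qed.

Lemma pa_comp_dom (G : groupType) (X : Type) (a : partial_action G X) g h x :
  dom a h^-1 x -> dom a g^-1 (act a h x) -> dom a (g * h)^-1 x.
Proof.
move=> hx ghx; rewrite invgM.
have [] := @act_dom _ _ a h^-1 (h^-1 * g^-1) x; last by [].
exists (act a h x); last exact: actK.
by split; rewrite invgK ?mulVKg//; apply: act_domL.
Qed.

Lemma pa_comp_subproof (G : groupType) (X : Type) (a : partial_action G X)
  (p q : pa_arrow a) : pa_src p = pa_tgt q ->
  dom a (pa_elt p * pa_elt q)^-1 (pa_src q).
Proof.
move=> pq; apply: pa_comp_dom; first exact: pa_srcP.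
by rewrite -/(pa_tgt q) -pq; apply: pa_srcP.
Qed.

Lemma pa_actM (G : groupType) (X : Type) (a : partial_action G X) g h x :
  dom a h^-1 x -> dom a g^-1 (act a h x) ->
  act a (g * h) x = act a g (act a h x).
Proof.
move=> hx ghx; rewrite actM //; split=> //.
by rewrite -invgM; apply: pa_comp_dom.
Qed.

Definition pa_unit (G : groupType) (X : Type) (a : partial_action G X) (x : X) :
  pa_arrow a := PaArrow (pa_unit_subproof a x).
Definition pa_inv (G : groupType) (X : Type) (a : partial_action G X)
  (p : pa_arrow a) : pa_arrow a := PaArrow (pa_inv_subproof p).
Definition pa_comp (G : groupType) (X : Type) (a : partial_action G X)
  (p q : pa_arrow a) (pq : pa_src p = pa_tgt q) : pa_arrow a :=
  PaArrow (pa_comp_subproof pq).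

Program Definition pa_groupoid (G : groupType) (X : Type)
    (a : partial_action G X) : groupoid X :=
  @Groupoid X (pa_arrow a) (@pa_src G X a) (@pa_tgt G X a) (@pa_unit G X a)
    (@pa_inv G X a) (@pa_comp G X a) _ _ _ _ _ _ _ _ _ _ _.
Next Obligation. by []. Qed.
Next Obligation. by move=> G X a x; apply: act1. Qed.
Next Obligation. by []. Qed.
Next Obligation. by move=> G X a p; apply: actK; apply: pa_srcP. Qed.
Next Obligation. by []. Qed.
Next Obligation.
move=> G X a p q pq /=; rewrite /pa_tgt /=.
rewrite pa_actM -/(pa_tgt q) -?pq //; apply: pa_srcP.
Qed.
Next Obligation. by move=> *; apply: pa_arrow_eq; rewrite /= ?mulgA. Qed.
Next Obligation. by move=> *; apply: pa_arrow_eq; rewrite /= ?mul1g. Qed.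
Next Obligation. by move=> *; apply: pa_arrow_eq; rewrite /= ?mulg1. Qed.
Next Obligation. by move=> *; apply: pa_arrow_eq; rewrite /= ?mulVg. Qed.
Next Obligation. by move=> *; apply: pa_arrow_eq; rewrite /= ?mulgV. Qed.

(** The group [G_Gamma]; [bracket a] is the generator attached to [a]. *)
Inductive univ_rel (X : Type) (C : groupoid X) : word C -> word C -> Prop :=
| univ_unit x : univ_rel [:: (false, unit_arrow C x)] [::]
| univ_comp (a b : C) (ab : src a = tgt b) :
    univ_rel [:: (false, a); (false, b)] [:: (false, comp ab)].

Definition univ_group (X : Type) (C : groupoid X) : groupType :=
  presented (@univ_rel X C).

Definition bracket (X : Type) (C : groupoid X) (a : C) : univ_group C :=
  pres_class (@univ_rel X C) [:: (false, a)].

Definition is_unit (X : Type) (C : groupoid X) (a : C) : Prop :=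
  exists x, a = unit_arrow C x.

Lemma comp_eq (X : Type) (C : groupoid X) (a a' b b' : C)
  (h : src a = tgt b) (h' : src a' = tgt b') :
  a = a' -> b = b' -> comp h = comp h'.
Proof. by move=> aa bb; subst a' b'; congr comp; apply: Prop_irrelevance. Qed.

Lemma comp_unitl (X : Type) (C : groupoid X) (a b : C) (h : src a = tgt b) :
  is_unit a -> comp h = b.
Proof.
case=> x ax; subst a; have xb : x = tgt b by rewrite -h src_unit.
subst x.
exact: comp1l.
Qed.

Lemma comp_unitr (X : Type) (C : groupoid X) (a b : C) (h : src a = tgt b) :
  is_unit b -> comp h = a.
Proof.
case=> x bx; subst b; have xa : x = src a by rewrite h tgt_unit.
subst x.
exact: comp1r.
Qed.

Lemma bracket_unit (X : Type) (C : groupoid X) (a : C) :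
  is_unit a -> bracket a = 1.
Proof. by case=> x ->; apply/pres_classP/pres_rel; apply: univ_unit. Qed.

Lemma bracket_comp (X : Type) (C : groupoid X) (a b : C) (h : src a = tgt b) :
  bracket (comp h) = bracket a * bracket b.
Proof.
rewrite /mul /= pres_mulE; apply/esym/pres_classP/pres_rel.
exact: univ_comp.
Qed.

Lemma bracketV (X : Type) (C : groupoid X) (a : C) :
  bracket (inv_arrow a) = (bracket a)^-1.
Proof.
apply: (mulgI (bracket a)); rewrite mulgV.
have h : src a = tgt (inv_arrow a) by rewrite tgt_inv.
rewrite -(bracket_comp h) compVr; apply: bracket_unit.
by exists (tgt a).
Qed.

(** [bracket] separates non-identity arrows: the universal group acts on
    reduced words, and [bracket a] maps the empty word to [a]. *)
Definition push_cons (X : Type) (C : groupoid X) (a : C) (w : seq C) : seq C :=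
  if pselect (is_unit a) then w else a :: w.

Definition push (X : Type) (C : groupoid X) (a : C) (w : seq C) : seq C :=
  if w is b :: w' then
    match pselect (src a = tgt b) with
    | left h => push_cons (comp h) w'
    | right _ => push_cons a w
    end
  else push_cons a w.

Fixpoint reduced (X : Type) (C : groupoid X) (w : seq C) : Prop :=
  if w is a :: w' then
    [/\ ~ is_unit a, (if w' is b :: _ then src a <> tgt b else True)
      & reduced w']
  else True.

Lemma push_consU (X : Type) (C : groupoid X) (a : C) (w : seq C) :
  is_unit a -> push_cons a w = w.
Proof. by rewrite /push_cons; case: pselect. Qed.

Lemma push_consN (X : Type) (C : groupoid X) (a : C) (w : seq C) :
  ~ is_unit a -> push_cons a w = a :: w.
Proof. by rewrite /push_cons; case: pselect. Qed.

Lemma pushE (X : Type) (C : groupoid X) (a : C) (w : seq C) :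
  (if w is b :: _ then src a <> tgt b else True) -> push a w = push_cons a w.
Proof. by case: w => //= b w ab; case: pselect. Qed.

Lemma pushh (X : Type) (C : groupoid X) (a b : C) (w : seq C)
  (h : src a = tgt b) : push a (b :: w) = push_cons (comp h) w.
Proof.
rewrite /=; case: pselect => // h'.
by rewrite (comp_eq h' h).
Qed.

Lemma push_unit (X : Type) (C : groupoid X) (a : C) (w : seq C) :
  is_unit a -> reduced w -> push a w = w.
Proof.
case: w => [|b w] ua //=; first by rewrite /push_cons; case: pselect.
case=> ub _ _; case: pselect => [h|_]; rewrite /push_cons.
  by rewrite comp_unitl //; case: pselect.
by case: pselect.
Qed.

Lemma push_reduced (X : Type) (C : groupoid X) (a : C) (w : seq C) :
  reduced w -> reduced (push a w).
Proof.
case: w => [|b w] /=; first by rewrite /push_cons; case: pselect.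
case=> ub bw rw; case: pselect => [h|nh]; rewrite /push_cons; case: pselect => //=.
by move=> nu; split=> //; case: w bw {rw} => // c w; rewrite src_comp.
Qed.

Lemma push_comp (X : Type) (C : groupoid X) (a b : C) (w : seq C)
  (h : src a = tgt b) : reduced w -> push a (push b w) = push (comp h) w.
Proof.
move=> rw.
have [ub|nub] := pselect (is_unit b).
  by rewrite (push_unit ub) // comp_unitr.
have [ua|nua] := pselect (is_unit a).
  by rewrite (push_unit ua) ?comp_unitl//; apply: push_reduced.
have nil_case (w' : seq C) : push a (b :: w') = push_cons (comp h) w'.
  exact: pushh.
case: w rw => [_|c w rcw].
  by rewrite (@pushE _ _ b) // (push_consN _ nub) nil_case.
have [nuc cw rw] := rcw.
have sab : src (comp h) = src b by apply: src_comp.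
have [bc|nbc] := pselect (src b = tgt c); last first.
  rewrite (@pushE _ _ b) // (push_consN _ nub) nil_case pushE //.
  by rewrite sab.
have abc : src (comp h) = tgt c by rewrite sab.
have a_bc : src a = tgt (comp bc) by rewrite tgt_comp.
rewrite (pushh w bc) (pushh w abc) (compA abc a_bc).
have [ubc|nubc] := pselect (is_unit (comp bc)).
  rewrite (push_consU _ ubc) (comp_unitr a_bc ubc) pushE //.
  case: w cw {rw rcw} => // d w.
  suff -> : src a = src c by [].
  case: ubc => x e.
  by rewrite h -(tgt_comp bc) -(src_comp bc) e tgt_unit src_unit.
by rewrite (push_consN _ nubc) (pushh w a_bc).
Qed.

Fixpoint ev_word (X : Type) (C : groupoid X) (u : word C) (w : seq C) : seq C :=
  if u is (b, a) :: u' then push (if b then inv_arrow a else a) (ev_word u' w)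
  else w.

Lemma ev_word_cat (X : Type) (C : groupoid X) (u v : word C) (w : seq C) :
  ev_word (u ++ v) w = ev_word u (ev_word v w).
Proof. by elim: u => [|[b a] u IH] //=; rewrite IH. Qed.

Lemma ev_word_reduced (X : Type) (C : groupoid X) (u : word C) (w : seq C) :
  reduced w -> reduced (ev_word u w).
Proof. by move=> rw; elim: u => [|[b a] u IH] //=; apply: push_reduced. Qed.

Lemma ev_word_eqv (X : Type) (C : groupoid X) (u v : word C) :
  pres_eqv (@univ_rel X C) u v ->
  forall w, reduced w -> ev_word u w = ev_word v w.
Proof.
elim=> {u v} [//|u v _ IH w rw|u v t _ IH1 _ IH2 w rw
  |u u' v v' _ IH1 _ IH2 w rw|b a w rw|u v].
- by rewrite IH.
- by rewrite IH1 // IH2.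
- by rewrite !ev_word_cat IH2 // IH1 //; apply: ev_word_reduced.
- have h1 : src a = tgt (inv_arrow a) by rewrite tgt_inv.
  have h2 : src (inv_arrow a) = tgt a by rewrite src_inv.
  case: b => /=.
    by rewrite (push_comp h2) // compVl push_unit //; exists (src a).
  by rewrite (push_comp h1) // compVr push_unit //; exists (tgt a).
- case=> [x|a b ab] w rw /=; first by rewrite push_unit //; exists x.
  by rewrite (push_comp ab).
Qed.

Lemma bracket_push (X : Type) (C : groupoid X) (a b : C) :
  bracket a = bracket b -> push_cons a [::] = push_cons b [::].
Proof. by move=> /pres_classP /ev_word_eqv /(_ [::] I). Qed.

Lemma bracket_inj (X : Type) (C : groupoid X) (a b : C) :
  ~ is_unit a -> bracket a = bracket b -> a = b.
Proof.
move=> nua /bracket_push; rewrite (push_consN _ nua) /push_cons.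
by case: pselect => // _ [].
Qed.

Lemma bracket_eq1 (X : Type) (C : groupoid X) (a : C) :
  bracket a = 1 -> is_unit a.
Proof.
move=> a1; have [//|nua] := pselect (is_unit a).
suff : push_cons a [::] = [::] by rewrite /push_cons; case: pselect.
have -> : [::] = ev_word [::] ([::] : seq C) by [].
have := @ev_word_eqv X C [:: (false, a)] [::] _ [::] I; apply.
exact/pres_classP.
Qed.

(** The partial action of the universal group on the objects. *)
Definition univ_dom (X : Type) (C : groupoid X) (g : univ_group C) : set X :=
  [set x | g = 1 \/ exists a : C, [/\ ~ is_unit a, g = bracket a & x = tgt a]].

(** [univ_act 1] is the identity, since [1] is not the [bracket] of a
    non-identity arrow; for a non-identity arrow [a], [univ_act (bracket a)] is
    constant equal to [tgt a], [a] being determined by [bracket a]. *)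
Definition univ_act (X : Type) (C : groupoid X) (g : univ_group C) (x : X) : X :=
  match pselect (exists a : C, ~ is_unit a /\ g = bracket a) with
  | left h => tgt (projT1 (cid h))
  | right _ => x
  end.

Lemma univ_domP (X : Type) (C : groupoid X) (g : univ_group C) x :
  univ_dom g x <-> exists2 a : C, g = bracket a & x = tgt a.
Proof.
split=> [[->|[a [_ -> ->]]]|[a -> ->]]; last 1 first.
- have [ua|nua] := pselect (is_unit a); last by right; exists a.
  by left; apply: bracket_unit.
- exists (unit_arrow C x); last by rewrite tgt_unit.
  by rewrite bracket_unit //; exists x.
- by exists a.
Qed.

Lemma univ_domVP (X : Type) (C : groupoid X) (g : univ_group C) x :
  univ_dom g^-1 x <-> exists2 a : C, g = bracket a & x = src a.
Proof.
split=> [/univ_domP[a ga ->]|[a -> ->]].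
  by exists (inv_arrow a); rewrite ?src_inv // bracketV -ga invgK.
by apply/univ_domP; exists (inv_arrow a); rewrite ?bracketV ?tgt_inv.
Qed.

Lemma univ_actE (X : Type) (C : groupoid X) (a : C) :
  univ_act (bracket a) (src a) = tgt a.
Proof.
rewrite /univ_act; case: pselect => [h|nh].
  by case: cid => b [nub ab] /=; rewrite (bracket_inj nub (esym ab)).
have [[x ->]|nua] := pselect (is_unit a); first by rewrite src_unit tgt_unit.
by case: nh; exists a.
Qed.

Lemma bracket_src (X : Type) (C : groupoid X) (a b : C) :
  bracket a = bracket b -> src a = src b <-> tgt a = tgt b.
Proof.
move=> ab; have [ua|nua] := pselect (is_unit a); last first.
  by rewrite (bracket_inj nua ab).
have [y yb] : is_unit b by apply: bracket_eq1; rewrite -ab bracket_unit.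
by case: ua => x ->; rewrite yb !src_unit !tgt_unit.
Qed.

Lemma univ_bij (X : Type) (C : groupoid X) (g : univ_group C) :
  set_bij (univ_dom g^-1) (univ_dom g) (univ_act g).
Proof.
split.
- move=> x /univ_domVP[a -> ->]; rewrite univ_actE.
  by apply/univ_domP; exists a.
- move=> x y /set_mem/univ_domVP[a ga ->] /set_mem/univ_domVP[b gb ->].
  rewrite {1}ga gb !univ_actE => ab.
  by apply/bracket_src => //; rewrite -ga gb.
- move=> x /univ_domP[a -> ->]; exists (src a); last exact: univ_actE.
  by apply/univ_domVP; exists a.
Qed.

Lemma univ_dom1 (X : Type) (C : groupoid X) :
  univ_dom (1 : univ_group C) = setT.
Proof. by apply/seteqP; split=> x // _; left. Qed.

Lemma univ_act1 (X : Type) (C : groupoid X) x :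
  univ_act (1 : univ_group C) x = x.
Proof.
have -> : 1 = bracket (unit_arrow C x).
  by rewrite bracket_unit //; exists x.
by rewrite -{2}(src_unit C x) univ_actE tgt_unit.
Qed.

Lemma univ_act_dom (X : Type) (C : groupoid X) (g h : univ_group C) :
  univ_act g @` (univ_dom g^-1 `&` univ_dom (g^-1 * h)) `<=`
  univ_dom g `&` univ_dom h.
Proof.
move=> _ [x [/univ_domVP[a ga xa] /univ_domP[b ghb xb]] <-].
rewrite {1}ga xa ga univ_actE; split; first by apply/univ_domP; exists a.
have ab : src a = tgt b by rewrite -xa.
apply/univ_domP; exists (comp ab); last by rewrite tgt_comp.
by rewrite bracket_comp -ghb -ga mulVKg.
Qed.

Lemma univ_actM (X : Type) (C : groupoid X) (g h : univ_group C) x :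
  (univ_dom h^-1 `&` univ_dom (h^-1 * g^-1)) x ->
  univ_act g (univ_act h x) = univ_act (g * h) x.
Proof.
rewrite -invgM => -[/univ_domVP[a ha xa] /univ_domVP[b ghb xb]].
have hab : src b = tgt (inv_arrow a) by rewrite tgt_inv -xa.
rewrite {1}ha {1}xa univ_actE ghb xb univ_actE.
have -> : g = bracket (comp hab).
  by rewrite bracket_comp bracketV -ghb -ha mulgK.
by rewrite -(src_inv a) -(src_comp hab) univ_actE tgt_comp.
Qed.

Definition univ_pa (X : Type) (C : groupoid X) :
  partial_action (univ_group C) X :=
  @PartialAction (univ_group C) X (@univ_dom X C) (@univ_act X C)
    (@univ_bij X C) (@univ_dom1 X C) (@univ_act1 X C) (@univ_act_dom X C)
    (@univ_actM X C).

Definition Wset (X : Type) (C : groupoid X) : set (normal_subgroup (univ_group C)) :=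
  [set N | forall g : univ_group C, N g -> g <> 1 ->
           forall a : C, g <> bracket a].
Arguments Wset {X} C.

(** Chains. The nonempty tuple [((x_1, g_1), ..., (x_n, g_n))] is given by its
    head [p = (x_1, g_1)] and its tail [c]. *)
Fixpoint is_chain (G : groupType) (X : Type) (a : partial_action G X)
    (R : X -> X -> Prop) (p : X * G) (c : seq (X * G)) : Prop :=
  dom a p.2 p.1 /\
  if c is q :: c' then R (act a p.2^-1 p.1) q.1 /\ is_chain a R q c' else True.

Record chain (G : groupType) (X : Type) (a : partial_action G X)
    (R : X -> X -> Prop) := Chain {
  chain_head : X * G;
  chain_tail : seq (X * G);
  chainP : is_chain a R chain_head chain_tail }.

Definition chain_tgt (G : groupType) (X : Type) (a : partial_action G X)
  (R : X -> X -> Prop) (c : chain a R) : X := (chain_head c).1.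

Definition chain_src (G : groupType) (X : Type) (a : partial_action G X)
  (R : X -> X -> Prop) (c : chain a R) : X :=
  let p := last (chain_head c) (chain_tail c) in act a p.2^-1 p.1.

Definition chain_eps (G : groupType) (X : Type) (a : partial_action G X)
  (R : X -> X -> Prop) (c : chain a R) : G :=
  \prod_(p <- chain_head c :: chain_tail c) p.2.

Definition pa_congruence (G : groupType) (X : Type) (a : partial_action G X)
    (R : X -> X -> Prop) (K : normal_subgroup G) : Prop :=
  RelationClasses.Equivalence R /\
  forall c o : chain a R, coset K (chain_eps c) = coset K (chain_eps o) ->
    R (chain_src c) (chain_src o) <-> R (chain_tgt c) (chain_tgt o).

Lemma is_chain_cat (G : groupType) (X : Type) (a : partial_action G X)
    (R : X -> X -> Prop) p c q d :
  is_chain a R p c -> is_chain a R q d ->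
  R (act a (last p c).2^-1 (last p c).1) q.1 ->
  is_chain a R p (c ++ q :: d).
Proof.
elim: c p => [|r c IH] p /=; first by move=> [pp _] qd pq.
by move=> [pp [pr rc]] qd cq; split=> //; split=> //; apply: IH.
Qed.

Lemma chain_cat (G : groupType) (X : Type) (a : partial_action G X)
    (R : X -> X -> Prop) (c o : chain a R) :
  R (chain_src c) (chain_tgt o) ->
  exists d : chain a R, [/\ chain_src d = chain_src o,
    chain_tgt d = chain_tgt c & chain_eps d = chain_eps c * chain_eps o].
Proof.
case: c o => [p c pc] [q d qd]; rewrite /chain_src /chain_tgt /= => cq.
exists (Chain (is_chain_cat pc qd cq)).
by rewrite /chain_src /chain_eps /= last_cat /= -cat_cons big_cat.
Qed.

Lemma chain_inv (G : groupType) (X : Type) (a : partial_action G X)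
    (R : X -> X -> Prop) (c : chain a R) : RelationClasses.Equivalence R ->
  exists d : chain a R, [/\ chain_src d = chain_tgt c,
    chain_tgt d = chain_src c & chain_eps d = (chain_eps c)^-1].
Proof.
case: c => [p c pc] [Rr Rs Rt].
rewrite /chain_src /chain_tgt /chain_eps /=.
have sing (r : X * G) : dom a r.2 r.1 ->
    is_chain a R (act a r.2^-1 r.1, r.2^-1) [::].
  by move=> rr; split=> //=; apply: act_domV.
elim: c p pc => [|q c IH] p /=.
  move=> [pp _]; exists (Chain (sing _ pp)).
  by rewrite /chain_src /chain_tgt /chain_eps /= invgK actVK // !big_seq1.
case=> pp [pq /IH[d [sd td ed]]].
case: (@chain_cat _ _ a R d (Chain (sing _ pp))).
  by rewrite [chain_src d]sd /chain_tgt /=; apply: Rs.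
move=> e [se te ee]; exists e; split.
- by rewrite -/(chain_src e) se /chain_src /= invgK actVK.
- by rewrite -/(chain_tgt e) te.
- by rewrite -/(chain_eps e) ee [chain_eps d]ed /chain_eps /= big_seq1
    [in RHS]big_cons invgM.
Qed.

(** The quotient partial action: [quo_act g] maps the class of [s(c)] to that of
    [t(c)] whenever the class of [eps(c)] is [g]; the value [y] outside
    [quo_dom g^-1] is a dummy. *)
Definition quo_dom (G : groupType) (X : Type) (a : partial_action G X)
    (R : X -> X -> Prop) (K : normal_subgroup G) (g : quo_group K) :
    set (quo R) :=
  [set y | exists2 c : chain a R,
             coset K (chain_eps c) = g & y = cls R (chain_tgt c)].

Definition quo_act (G : groupType) (X : Type) (a : partial_action G X)
    (R : X -> X -> Prop) (K : normal_subgroup G) (g : quo_group K)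
    (y : quo R) : quo R :=
  match pselect (exists c : chain a R,
           coset K (chain_eps c) = g /\ y = cls R (chain_src c)) with
  | left h => cls R (chain_tgt (projT1 (cid h)))
  | right _ => y
  end.

Section QuotientPartialAction.
Variables (G : groupType) (X : Type) (a : partial_action G X).
Variables (R : X -> X -> Prop) (K : normal_subgroup G).
Hypothesis cong : pa_congruence a R K.

Let eqR : RelationClasses.Equivalence R := proj1 cong.

Lemma quo_actE (c : chain a R) :
  quo_act a (coset K (chain_eps c)) (cls R (chain_src c)) =
  cls R (chain_tgt c).
Proof.
rewrite /quo_act; case: pselect => [h|[]]; last by exists c.
case: cid => d [ed /(cls_eqP _ _ eqR) sd] /=.
by apply/(cls_eqP _ _ eqR); apply/(proj2 cong) => //; case: eqR => _ + _; apply.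
Qed.

Lemma quo_domVP (g : quo_group K) (y : quo R) :
  quo_dom a g^-1 y <-> exists2 c : chain a R,
    coset K (chain_eps c) = g & y = cls R (chain_src c).
Proof.
split=> -[c cg ->]; have [d [sd td ed]] := chain_inv c eqR; exists d.
- by rewrite ed cosetV cg invgK.
- by rewrite sd.
- by rewrite ed cosetV cg.
- by rewrite td.
Qed.

Lemma quo_bij (g : quo_group K) :
  set_bij (quo_dom (R := R) a g^-1) (quo_dom a g) (quo_act a g).
Proof.
split.
- by move=> y /quo_domVP[c <- ->]; rewrite quo_actE; exists c.
- move=> x y /set_mem/quo_domVP[c cg ->] /set_mem/quo_domVP[d dg ->].
  rewrite -{1}cg -dg !quo_actE => /(cls_eqP _ _ eqR) t.
  by apply/(cls_eqP _ _ eqR); apply/(proj2 cong) => //; rewrite cg.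
- move=> y [c <- ->]; exists (cls R (chain_src c)); last exact: quo_actE.
  by apply/quo_domVP; exists c.
Qed.

Lemma is_chain1 x : is_chain a R (x, 1) [::].
Proof. by rewrite /= dom1. Qed.

Lemma chain1E x : coset K (chain_eps (Chain (is_chain1 x))) = 1.
Proof. by rewrite /chain_eps /= big_seq1. Qed.

Lemma quo_dom1 : quo_dom a (1 : quo_group K) = [set: quo R].
Proof.
apply/seteqP; split=> y // _; have [x ->] := quo_repr_subproof y.
by exists (Chain (is_chain1 x)); first exact: chain1E.
Qed.

Lemma quo_act1 (y : quo R) : quo_act a (1 : quo_group K) y = y.
Proof.
have [x ->] := quo_repr_subproof y.
have := quo_actE (Chain (is_chain1 x)).
by rewrite chain1E /chain_src /= invg1 act1.
Qed.

Lemma quo_act_dom (g h : quo_group K) :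
  quo_act a g @` (quo_dom (R := R) a g^-1 `&` quo_dom a (g^-1 * h)) `<=`
  quo_dom a g `&` quo_dom a h.
Proof.
move=> _ [y [/quo_domVP[c cg yc] [d dh yd]] <-].
have -> : quo_act a g y = cls R (chain_tgt c) by rewrite yc -cg quo_actE.
split; first by exists c.
have [|e [_ te ee]] := @chain_cat _ _ a R c d.
  by apply/(cls_eqP _ _ eqR); rewrite -yc.
by exists e; rewrite ?te // ee cosetM cg dh mulVKg.
Qed.

Lemma quo_actM (g h : quo_group K) (y : quo R) :
  (quo_dom a h^-1 `&` quo_dom a (h^-1 * g^-1)) y ->
  quo_act a g (quo_act a h y) = quo_act a (g * h) y.
Proof.
rewrite -invgM => -[/quo_domVP[c ch yc] /quo_domVP[d dgh yd]].
have -> : quo_act a h y = cls R (chain_tgt c) by rewrite yc -ch quo_actE.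
have -> : quo_act a (g * h) y = cls R (chain_tgt d) by rewrite yd -dgh quo_actE.
have [c' [sc tc ec]] := chain_inv c eqR.
have [|e [se te ee]] := @chain_cat _ _ a R d c'.
  by apply/(cls_eqP _ _ eqR); rewrite tc -yc yd.
have -> : g = coset K (chain_eps e).
  by rewrite ee ec cosetM cosetV ch dgh mulgK.
by rewrite -sc -se quo_actE te.
Qed.

Definition quo_pa : partial_action (quo_group K) (quo R) :=
  @PartialAction (quo_group K) (quo R) (@quo_dom G X a R K)
    (@quo_act G X a R K) quo_bij quo_dom1 quo_act1 quo_act_dom quo_actM.

End QuotientPartialAction.

Definition diag_rel (X : Type) (x y : X) : Prop := x = y.

Lemma diag_chain (X : Type) (C : groupoid X)
    (c : chain (univ_pa C) (@diag_rel X)) :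
  exists a : C, [/\ chain_eps c = bracket a, chain_src c = src a
                  & chain_tgt c = tgt a].
Proof.
case: c => [p c pc]; rewrite /chain_src /chain_tgt /chain_eps /=.
have one (q : X * univ_group C) : univ_dom q.2 q.1 ->
    exists a : C, [/\ q.2 = bracket a, univ_act q.2^-1 q.1 = src a
                    & q.1 = tgt a].
  move=> /univ_domP[a qa xa]; exists a; split=> //.
  by rewrite qa xa -bracketV -src_inv univ_actE tgt_inv.
elim: c p pc => [|q c IH] p /=.
  by case=> /one[a [pa sa ta]] _; exists a; rewrite big_seq1.
case=> /one[a [pa sa ta]] [pq /IH[b [eb sb tb]]].
have ab : src a = tgt b by rewrite -sa -tb.
exists (comp ab).
by rewrite big_cons eb bracket_comp pa src_comp tgt_comp.
Qed.

Lemma Wset_congruence (X : Type) (C : groupoid X)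
    (N : normal_subgroup (univ_group C)) :
  Wset C N -> pa_congruence (univ_pa C) (@diag_rel X) N.
Proof.
move=> WN; split; first by split=> [x|x y|x y z] //; rewrite /diag_rel => ->.
move=> c o; have [a [-> -> ->]] := diag_chain c.
have [b [-> -> ->]] := diag_chain o.
have unitN (d : C) : N (bracket d) -> is_unit d.
  move=> Nd; apply: bracket_eq1; have [//|d1] := pselect (bracket d = 1).
  by case: (WN _ Nd d1 d).
move=> /coset_eqP Nab; split=> [sab|tab].
  have h : src a = tgt (inv_arrow b) by rewrite tgt_inv.
  have [x e] : is_unit (comp h).
    apply: unitN; rewrite bracket_comp bracketV.
    have -> : bracket a / bracket b =
              (((bracket a)^-1 * bracket b) ^ (bracket a)^-1)^-1.
      by rewrite /conjg !invgM !invgK !mulgA mulgK.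
    by apply: subgroupV; apply: normalJ.
  by rewrite /diag_rel -(tgt_comp h) -(src_inv b) -(src_comp h) e tgt_unit src_unit.
have h : src (inv_arrow a) = tgt b by rewrite src_inv.
have [x e] : is_unit (comp h) by apply: unitN; rewrite bracket_comp bracketV.
by rewrite /diag_rel -(tgt_inv a) -(tgt_comp h) -(src_comp h) e tgt_unit src_unit.
Qed.

(* Main.v *)
(** The group [univ_group C] and its partial action [univ_pa C] are universal:
    functors from [C] to [pa_groupoid theta] correspond to morphisms from
    [univ_pa C] to [theta], and [C] itself is [pa_groupoid (univ_pa C)].

    If [C] is isomorphic to [pa_groupoid theta], where the group of [theta] is
    generated by the elements with nonempty domain, the resulting morphism from
    [univ_pa C] to [theta] is onto, and the kernel [N] of its group part is in
    [Wset C] because only units of [pa_groupoid theta] lie over [1]. The first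
    isomorphism theorem then presents [theta] as the quotient by [N].
    Conversely, chains for the diagonal relation collapse to single arrows, so
    passing to the quotient by [N] in [Wset C] does not change the groupoid of
    the partial action, and neither does passing from [theta] to [red theta]. *)
From mathcomp Require Import all_boot.
From mathcomp Require Import boolp classical_sets functions.
Require Import Defs.

Set Implicit Arguments.
Unset Strict Implicit.
Unset Printing Implicit Defensive.

#[local] Obligation Tactic := idtac.

Import Algebra.

Local Open Scope classical_set_scope.
Local Open Scope group_scope.

Definition surjective (T U : Type) (f : T -> U) : Prop :=
  forall y, exists x, f x = y.

Lemma inj_surj_bij (T U : Type) (f : T -> U) :
  injective f -> surjective f -> bijective f.
Proof.
move=> f_inj f_surj; rewrite -setTT_bijective.
split=> // [x y _ _ /f_inj //|y _].
by have [x <-] := f_surj y; exists x.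
Qed.

Section QuotientLift.
Variables (T U : Type) (R : T -> T -> Prop) (f : T -> U).
Hypothesis R_kerP : forall x y, R x y <-> f x = f y.

Lemma kernel_rel_equiv : RelationClasses.Equivalence R.
Proof.
split=> [x|x y|x y z]; first exact/R_kerP.
  by move=> /R_kerP xy; apply/R_kerP.
by move=> /R_kerP xy /R_kerP yz; apply/R_kerP; rewrite xy.
Qed.

Definition quo_lift (q : quo R) : U := f (quo_repr q).

Lemma quo_liftE x : quo_lift (cls R x) = f x.
Proof. by apply/R_kerP; apply: repr_clsP; apply: kernel_rel_equiv. Qed.

Lemma quo_lift_bij : surjective f -> bijective quo_lift.
Proof.
move=> f_surj; apply: inj_surj_bij => [p q pq|y].
  by rewrite -[p]quo_reprK -[q]quo_reprK; apply/cls_eqP/R_kerP => //;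
    apply: kernel_rel_equiv.
by have [x <-] := f_surj y; exists (cls R x); apply: quo_liftE.
Qed.

End QuotientLift.

Lemma diag_cls_bij (X : Type) : bijective (cls (@diag_rel X)).
Proof.
exists (quo_lift (R := @diag_rel X) id); last exact: quo_reprK.
by move=> x; apply: quo_liftE.
Qed.

Section GroupMorphism.
Variables (G H : groupType) (f : G -> H).
Hypothesis f_morph : monoid_morphism f.

Lemma monoid_morphismV g : f g^-1 = (f g)^-1.
Proof. by apply: (mulgI (f g)); rewrite -f_morph !mulgV f_morph. Qed.

Program Definition kernel : normal_subgroup G :=
  @NormalSubgroup G (@Subgroup G [set g | f g = 1] _ _ _) _.
Next Obligation. exact: f_morph.1. Qed.
Next Obligation. by move=> x y /= fx fy; rewrite f_morph fx fy mulg1. Qed.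
Next Obligation. by move=> x /= fx; rewrite monoid_morphismV fx invg1. Qed.
Next Obligation.
by move=> x g /= fx; rewrite /conjg !f_morph fx mul1g -f_morph mulVg f_morph.
Qed.

Program Definition image_subgroup (K : subgroup G) : subgroup H :=
  @Subgroup H (f @` K) _ _ _.
Next Obligation.
by move=> K; exists 1; [apply: subgroup1|apply: f_morph.1].
Qed.
Next Obligation.
move=> K _ _ [x Kx <-] [y Ky <-]; exists (x * y); first exact: subgroupM.
exact: f_morph.2.
Qed.
Next Obligation.
move=> K _ [x Kx <-]; exists x^-1; first exact: subgroupV.
exact: monoid_morphismV.
Qed.

Lemma gen_subgroup_sub_image (K : subgroup G) (S : set H) :
  S `<=` f @` K -> gen_subgroup S `<=` f @` K.
Proof. by move=> SK h h_gen; apply: (h_gen (image_subgroup K)). Qed.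

Lemma coset_rel_morphP (K : normal_subgroup G) :
  (forall g, K g <-> f g = 1) ->
  forall g h, coset_rel K g h <-> f g = f h.
Proof.
move=> K_kerP g h; rewrite /coset_rel K_kerP f_morph monoid_morphismV.
split=> [gh|->]; last exact: mulVg.
by apply: (mulgI (f g)^-1); rewrite gh mulVg.
Qed.

End GroupMorphism.

Lemma sub_gen_subgroup (G : groupType) (S : set G) : S `<=` gen_subgroup S.
Proof. by move=> g Sg H; apply. Qed.

Lemma val_morph (G : groupType) (H : subgroup G) :
  monoid_morphism (val : subgroup_type H -> G).
Proof. by []. Qed.

Lemma coset_eq1P (G : groupType) (N : normal_subgroup G) (g : G) :
  coset N g = 1 <-> N g.
Proof.
rewrite -coset1; split=> [/esym|Ng]; first by rewrite coset_eqP invg1 mul1g.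
by apply/esym/coset_eqP; rewrite invg1 mul1g.
Qed.

Section PresentedLift.
Variables (S : Type) (r : word S -> word S -> Prop).
Variables (H : groupType) (f : S -> H).

Definition word_eval (u : word S) : H :=
  \prod_(l <- u) (if l.1 then (f l.2)^-1 else f l.2).

Lemma word_eval_cat u v : word_eval (u ++ v) = word_eval u * word_eval v.
Proof. exact: big_cat. Qed.

Hypothesis f_rel : forall u v, r u v -> word_eval u = word_eval v.

Lemma word_eval_eqv u v : pres_eqv r u v -> word_eval u = word_eval v.
Proof.
elim=> {u v} [//|//|u v w _ -> _ -> //|u u' v v' _ uu' _ vv'|b s|u v /f_rel//].
- by rewrite !word_eval_cat uu' vv'.
- rewrite /word_eval big_cons big_seq1 big_nil.
  by case: b; rewrite ?mulVg ?mulgV.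
Qed.

Definition pres_lift (x : presented r) : H := word_eval (quo_repr x).

Lemma pres_liftE u : pres_lift (pres_class r u) = word_eval u.
Proof. by apply: word_eval_eqv; apply: repr_clsP; apply: pres_equiv. Qed.

Lemma pres_lift_morph : monoid_morphism pres_lift.
Proof.
split; first by rewrite [LHS]pres_liftE /word_eval big_nil.
move=> x y; have [u ->] := pres_class_repr x; have [v ->] := pres_class_repr y.
by rewrite {1}/mul /= pres_mulE !pres_liftE word_eval_cat.
Qed.

End PresentedLift.

Lemma groupoid_isomorphic_sym (X Y : Type) (C : groupoid X) (D : groupoid Y) :
  groupoid_isomorphic C D -> groupoid_isomorphic D C.
Proof.
by move=> [f0 [f1 [k0 [k1 [? ? [? ?] [? ?]]]]]]; exists k0, k1, f0, f1.
Qed.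

Lemma groupoid_morphism_comp (X Y Z : Type) (C : groupoid X) (D : groupoid Y)
    (E : groupoid Z) (f0 : X -> Y) (f1 : C -> D) (k0 : Y -> Z) (k1 : D -> E) :
  groupoid_morphism f0 f1 -> groupoid_morphism k0 k1 ->
  groupoid_morphism (k0 \o f0) (k1 \o f1).
Proof.
move=> [fs ft fu fc] [ks kt ku kc]; split=> [a|a|x|a b ab kfab] /=.
- by rewrite ks fs.
- by rewrite kt ft.
- by rewrite fu ku.
- have fab : src (f1 a) = tgt (f1 b) by rewrite fs ft ab.
  by rewrite (fc _ _ ab fab) kc.
Qed.

Lemma groupoid_isomorphic_trans (X Y Z : Type) (C : groupoid X) (D : groupoid Y)
    (E : groupoid Z) :
  groupoid_isomorphic C D -> groupoid_isomorphic D E -> groupoid_isomorphic C E.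
Proof.
move=> [f0 [f1 [f0' [f1' [fP f'P [f0K f0'K] [f1K f1'K]]]]]].
move=> [k0 [k1 [k0' [k1' [kP k'P [k0K k0'K] [k1K k1'K]]]]]].
exists (k0 \o f0), (k1 \o f1), (f0' \o k0'), (f1' \o k1').
by split; [apply: groupoid_morphism_comp|apply: groupoid_morphism_comp
  |split; apply: can_comp|split; apply: can_comp].
Qed.

Lemma bij_groupoid_isomorphic (X Y : Type) (C : groupoid X) (D : groupoid Y)
    (f0 : X -> Y) (f1 : C -> D) :
  groupoid_morphism f0 f1 -> bijective f0 -> bijective f1 ->
  groupoid_isomorphic C D.
Proof.
move=> fP [k0 f0K k0K] [k1 f1K k1K]; exists f0, f1, k0, k1; split=> //.
have [fs ft fu fc] := fP; split.
- by move=> d; rewrite -{2}(k1K d) fs f0K.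
- by move=> d; rewrite -{2}(k1K d) ft f0K.
- by move=> y; apply: (can_inj f1K); rewrite fu k0K k1K.
- move=> a b ab kab; apply: (can_inj f1K).
  have fab : src (f1 (k1 a)) = tgt (f1 (k1 b)) by rewrite !k1K.
  by rewrite k1K (fc _ _ kab fab); apply: comp_eq; rewrite k1K.
Qed.

Lemma pa_isomorphic_sym (G H : groupType) (X Y : Type)
    (a : partial_action G X) (b : partial_action H Y) :
  pa_isomorphic a b -> pa_isomorphic b a.
Proof.
by move=> [f0 [f1 [k0 [k1 [? ? [? ?] [? ?]]]]]]; exists k0, k1, f0, f1.
Qed.

Section ArrowMap.
Variables (G H : groupType) (X Y : Type).
Variables (a : partial_action G X) (b : partial_action H Y).
Variables (phi0 : X -> Y) (phi1 : G -> H).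
Hypothesis phi_morph : pa_morphism a b phi0 phi1.

Lemma pa_morphism_domV g x : dom a g^-1 x -> dom b (phi1 g)^-1 (phi0 x).
Proof.
have [phi1_morph phi_dom _] := phi_morph; move=> gx.
by rewrite -monoid_morphismV //; apply: phi_dom; exists x.
Qed.

Definition pa_arrow_map (p : pa_groupoid a) : pa_groupoid b :=
  PaArrow (pa_morphism_domV (pa_srcP p)).

Lemma pa_arrow_map_tgt p : tgt (pa_arrow_map p) = phi0 (tgt p).
Proof.
have [_ _ phi_act] := phi_morph.
by rewrite [RHS]phi_act //; apply: pa_srcP.
Qed.

Lemma pa_arrow_map_morphism : groupoid_morphism phi0 pa_arrow_map.
Proof.
have [phi1_morph _ _] := phi_morph; split=> // [p|x|p q pq phi_pq].
- exact: pa_arrow_map_tgt.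
- by apply: pa_arrow_eq => //; apply: phi1_morph.1.
- by apply: pa_arrow_eq => //; apply: phi1_morph.2.
Qed.

Lemma bij_pa_isomorphic :
  bijective phi0 -> bijective phi1 -> surjective pa_arrow_map ->
  pa_isomorphic a b.
Proof.
move=> [psi0 phi0K psi0K] [psi1 phi1K psi1K] arrow_surj.
have [phi1_morph _ phi_act] := phi_morph.
have psi1_morph : monoid_morphism psi1.
  by split=> [|g h]; apply: (can_inj phi1K); rewrite ?phi1_morph !psi1K.
have psi_dom s y : dom b s^-1 y -> dom a (psi1 s)^-1 (psi0 y).
  move=> sy; have [[g x gx] [<- <-]] := arrow_surj (PaArrow sy).
  by rewrite phi0K phi1K.
exists phi0, phi1, psi0, psi1; split=> //; split=> //.
- move=> s _ [y sy <-]; rewrite -[s]invgK monoid_morphismV //.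
  by apply: psi_dom; rewrite invgK.
- move=> s y sy; apply: (can_inj phi0K).
  by rewrite psi0K phi_act ?psi0K ?psi1K //; apply: psi_dom.
Qed.

End ArrowMap.

Lemma pa_groupoid_isomorphic (G H : groupType) (X Y : Type)
    (a : partial_action G X) (b : partial_action H Y) :
  pa_isomorphic a b -> groupoid_isomorphic (pa_groupoid a) (pa_groupoid b).
Proof.
move=> [f0 [f1 [k0 [k1 [fP kP [f0K k0K] [f1K k1K]]]]]].
apply: (bij_groupoid_isomorphic (pa_arrow_map_morphism fP)); first by exists k0.
by exists (pa_arrow_map kP) => p; apply: pa_arrow_eq => /=.
Qed.

Section Reduction.
Variables (G : groupType) (X : Type) (a : partial_action G X).

Definition pa_reduced : Prop := forall g, red_subgroup a g.

Lemma red_subgroup_elt (p : pa_arrow a) : red_subgroup a (pa_elt p).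
Proof. by apply: sub_gen_subgroup; exists (pa_src p); apply: pa_srcP. Qed.

Lemma red_val_morphism : pa_morphism (red a) a id val.
Proof. by split=> // g _ [x gx <-]. Qed.

Lemma pa_groupoid_red :
  groupoid_isomorphic (pa_groupoid (red a)) (pa_groupoid a).
Proof.
apply: (bij_groupoid_isomorphic (pa_arrow_map_morphism red_val_morphism)).
  by exists id.
apply: inj_surj_bij => [p q pq|[g x gx]].
  have := congr1 (@pa_elt _ _ _) pq; have := congr1 (@pa_src _ _ _) pq.
  by move=> /= pq_src /val_inj pq_elt; apply: pa_arrow_eq.
have g_red : `[< red_subgroup a g >].
  by apply/asboolP; apply: (red_subgroup_elt (PaArrow gx)).
have gx_red : dom (red a) (Sub g g_red : red_group a)^-1 x by [].
by exists (PaArrow gx_red); apply: pa_arrow_eq.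
Qed.

End Reduction.

Lemma red_reduced (G : groupType) (X : Type) (a : partial_action G X) :
  pa_reduced (red a).
Proof.
move=> g; have /asboolP := valP g.
have val_surj : [set h | dom a h^-1 !=set0] `<=` val @` red_subgroup (red a).
  move=> h [x hx]; have h_red : `[< red_subgroup a h >].
    by apply/asboolP; apply: (red_subgroup_elt (PaArrow hx)).
  exists (Sub h h_red : red_group a) => //.
  by apply: sub_gen_subgroup; exists x.
move=> /(gen_subgroup_sub_image (@val_morph _ _) val_surj)[h h_red].
by move=> /val_inj <-.
Qed.

Lemma chain_image (G H : groupType) (X Y : Type) (a : partial_action G X)
    (b : partial_action H Y) (phi0 : X -> Y) (phi1 : G -> H)
    (R : X -> X -> Prop) (c : chain a R) :
  pa_morphism a b phi0 phi1 -> (forall x y, R x y -> phi0 x = phi0 y) ->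
  exists p : pa_groupoid b, [/\ pa_elt p = phi1 (chain_eps c),
    src p = phi0 (chain_src c) & tgt p = phi0 (chain_tgt c)].
Proof.
move=> phi_morph R_phi0; have [[_ phi1M] _ _] := phi_morph.
have arrow_of (q : X * G) : dom a q.2 q.1 -> exists p : pa_groupoid b,
    [/\ pa_elt p = phi1 q.2, src p = phi0 (act a q.2^-1 q.1)
      & tgt p = phi0 q.1].
  move=> q_dom; have qx := act_domV q_dom.
  exists (pa_arrow_map phi_morph (PaArrow qx)); split=> //.
  by rewrite pa_arrow_map_tgt /= /pa_tgt /= actVK.
case: c => [q c qc]; rewrite /chain_src /chain_tgt /chain_eps /=.
elim: c q qc => [|r c IH] q /=; first by rewrite big_seq1 => -[/arrow_of].
move=> [/arrow_of[p [p_elt p_src p_tgt]] [/R_phi0 qr]].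
move=> /IH[p' [p'_elt p'_src p'_tgt]].
have pp' : src p = tgt (p' : pa_groupoid b) by rewrite p_src [RHS]p'_tgt.
exists (comp pp'); split; first by rewrite big_cons phi1M -p_elt -p'_elt.
  exact: p'_src.
by rewrite -p_tgt; apply: (tgt_comp pp').
Qed.

Lemma singleton_chain (G : groupType) (X : Type) (a : partial_action G X)
    (R : X -> X -> Prop) g x : dom a g x ->
  exists c : chain a R,
    [/\ chain_eps c = g, chain_src c = act a g^-1 x & chain_tgt c = x].
Proof.
move=> gx; have gx_chain : is_chain a R (x, g) [::] by [].
by exists (Chain gx_chain); rewrite /chain_eps /= big_seq1.
Qed.

Lemma quo_morphism (G : groupType) (X : Type) (a : partial_action G X)
    (R : X -> X -> Prop) (K : normal_subgroup G) (cong : pa_congruence a R K) :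
  pa_morphism a (quo_pa cong) (cls R) (coset K).
Proof.
split; first by split=> // g h; apply: cosetM.
- by move=> g _ [x /(singleton_chain R)[c [<- _ <-]] <-]; exists c.
- move=> g x gx.
  have [c [c_eps c_src c_tgt]] := singleton_chain R (act_domL gx).
  by have := quo_actE cong c; rewrite c_eps c_src c_tgt actK.
Qed.

Section FirstIsomorphism.
Variables (G H : groupType) (X Y : Type).
Variables (a : partial_action G X) (b : partial_action H Y).
Variables (phi0 : X -> Y) (phi1 : G -> H).
Hypothesis phi_morph : pa_morphism a b phi0 phi1.
Variables (R : X -> X -> Prop) (K : normal_subgroup G).
Hypothesis cong : pa_congruence a R K.
Hypothesis R_kerP : forall x y, R x y <-> phi0 x = phi0 y.
Hypothesis K_kerP : forall g, K g <-> phi1 g = 1.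

Let coset_relP g h : coset_rel K g h <-> phi1 g = phi1 h.
Proof. by have [phi1_morph _ _] := phi_morph; apply: coset_rel_morphP. Qed.

Lemma quo_lift_morphism : pa_morphism (quo_pa cong) b
  (quo_lift (R := R) phi0) (quo_lift (R := coset_rel K) phi1).
Proof.
have [phi1_morph _ _] := phi_morph.
have R_phi0 x y : R x y -> phi0 x = phi0 y by move/R_kerP.
have liftE0 := quo_liftE R_kerP; have liftE1 := quo_liftE coset_relP.
split.
- split; first by rewrite -coset1 liftE1 phi1_morph.
  move=> p q; have [g ->] := coset_repr p; have [h ->] := coset_repr q.
  by rewrite -cosetM !liftE1 phi1_morph.
- move=> _ _ [_ [c <- ->] <-]; rewrite liftE0 liftE1.
  have [p [<- _ <-]] := chain_image c phi_morph R_phi0.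
  exact/act_domL/pa_srcP.
- move=> _ _ /(quo_domVP cong)[c <- ->].
  rewrite [act _ _ _](quo_actE cong) !liftE0 liftE1.
  by have [p [<- <- <-]] := chain_image c phi_morph R_phi0.
Qed.

Lemma quo_pa_isomorphic :
  surjective phi0 -> surjective phi1 -> surjective (pa_arrow_map phi_morph) ->
  pa_isomorphic (quo_pa cong) b.
Proof.
move=> phi0_surj phi1_surj arrow_surj.
apply: (bij_pa_isomorphic (phi_morph := quo_lift_morphism)).
- exact: (quo_lift_bij R_kerP).
- exact: (quo_lift_bij coset_relP).
move=> p; have [q <-] := arrow_surj p.
exists (pa_arrow_map (quo_morphism cong) q); apply: pa_arrow_eq => /=.
  exact: (quo_liftE coset_relP).
exact: (quo_liftE R_kerP).
Qed.

End FirstIsomorphism.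

Lemma pa_groupoid_quo_diag (G : groupType) (X : Type) (a : partial_action G X)
    (K : normal_subgroup G) (cong : pa_congruence a (@diag_rel X) K) :
  (forall g h x, dom a g^-1 x -> dom a h^-1 x -> coset K g = coset K h ->
    g = h) ->
  groupoid_isomorphic (pa_groupoid a) (pa_groupoid (quo_pa cong)).
Proof.
move=> coset_inj.
apply: (bij_groupoid_isomorphic (pa_arrow_map_morphism (quo_morphism cong))).
  exact: diag_cls_bij.
apply: inj_surj_bij => [p q pq|[g y gy]].
  have src_pq : pa_src p = pa_src q.
    exact/(bij_inj (@diag_cls_bij X))/(congr1 (@pa_src _ _ _) pq).
  apply: pa_arrow_eq => //; apply: (coset_inj _ _ (pa_src p)).
  - exact: pa_srcP.
  - by rewrite src_pq; apply: pa_srcP.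
  - exact: (congr1 (@pa_elt _ _ _) pq).
have /(quo_domVP cong)[c c_eps c_src] := gy.
have id_morph : pa_morphism a a id id by split=> // h _ [x hx <-].
have [p [p_elt p_src _]] := chain_image c id_morph (fun x y xy => xy).
exists p; apply: pa_arrow_eq => /=; first by rewrite p_elt.
by rewrite c_src -p_src.
Qed.

Section Cocycle.
Variables (X : Type) (C : groupoid X) (H : groupType).

Definition cocycle (c : C -> H) : Prop :=
  forall (a b : C) (ab : src a = tgt b), c (comp ab) = c a * c b.

Variable c : C -> H.
Hypothesis cP : cocycle c.

Lemma cocycle_unit x : c (unit_arrow C x) = 1.
Proof.
have unit_unit : src (unit_arrow C x) = tgt (unit_arrow C x).
  by rewrite src_unit tgt_unit.
apply: (mulgI (c (unit_arrow C x))).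
by rewrite mulg1 -(cP unit_unit) comp_unitl //; exists x.
Qed.

Lemma cocycle_word_eval u v : univ_rel u v -> word_eval c u = word_eval c v.
Proof.
by case=> [x|a b ab];
  rewrite /word_eval ?big_cons !big_nil ?mulg1 /= ?cocycle_unit ?cP.
Qed.

Definition univ_lift : univ_group C -> H := pres_lift c (r := @univ_rel X C).

Lemma univ_liftE a : univ_lift (bracket a) = c a.
Proof. by rewrite [LHS](pres_liftE cocycle_word_eval) /word_eval big_seq1. Qed.

Lemma univ_lift_morph : monoid_morphism univ_lift.
Proof. exact: pres_lift_morph cocycle_word_eval. Qed.

End Cocycle.

Section UniversalAction.
Variables (X : Type) (C : groupoid X).

Lemma bracket_src_inj (a b : C) :
  bracket a = bracket b -> src a = src b -> a = b.
Proof.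
move=> ab src_ab; have [[x ax]|/bracket_inj] := pselect (is_unit a); last exact.
have [y yb] : is_unit b.
  by apply: bracket_eq1; rewrite -ab bracket_unit //; exists x.
by move: src_ab; rewrite ax yb !src_unit => ->.
Qed.

Lemma bracket_domV (a : C) : dom (univ_pa C) (bracket a)^-1 (src a).
Proof. by apply/univ_domVP; exists a. Qed.

Definition bracket_arrow (a : C) : pa_groupoid (univ_pa C) :=
  PaArrow (bracket_domV a).

Lemma univ_pa_groupoid : groupoid_isomorphic C (pa_groupoid (univ_pa C)).
Proof.
apply: (@bij_groupoid_isomorphic _ _ _ _ id bracket_arrow).
- split=> [//|a|x|a b ab src_ab].
  + exact: univ_actE.
  + apply: pa_arrow_eq => /=; last exact: src_unit.
    by apply: bracket_unit; exists x.
  + by apply: pa_arrow_eq => /=; [apply: bracket_comp|apply: src_comp].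
- by exists id.
apply: inj_surj_bij => [a b ab|[g x gx]].
  apply: bracket_src_inj; first exact: (congr1 (@pa_elt _ _ _) ab).
  exact: (congr1 (@pa_src _ _ _) ab).
have /univ_domVP[a ga xa] := gx.
by exists a; apply: pa_arrow_eq.
Qed.

Lemma WsetP (N : normal_subgroup (univ_group C)) :
  Wset C N <-> forall a, N (bracket a) -> bracket a = 1.
Proof.
split=> [WN a Na|N_bracket g Ng g1 a ga].
  by have [//|a1] := pselect (bracket a = 1); have /(_ a) := WN _ Na a1.
by apply: g1; rewrite ga N_bracket // -ga.
Qed.

Lemma Wset_coset_inj (N : normal_subgroup (univ_group C)) g h x : Wset C N ->
  dom (univ_pa C) g^-1 x -> dom (univ_pa C) h^-1 x ->
  coset N g = coset N h -> g = h.
Proof.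
move=> /WsetP WN /univ_domVP[a -> xa] /univ_domVP[b -> xb] coset_ab.
have ab : src a = tgt (inv_arrow b) by rewrite tgt_inv -xa.
have: bracket (comp ab) = 1.
  by apply: WN; apply/coset_eq1P;
    rewrite bracket_comp bracketV cosetM cosetV coset_ab mulgV.
by rewrite bracket_comp bracketV => /divg1_eq.
Qed.

Lemma pa_groupoid_quo_univ (N : normal_subgroup (univ_group C))
    (WN : Wset C N) :
  groupoid_isomorphic (pa_groupoid (quo_pa (Wset_congruence WN))) C.
Proof.
apply: groupoid_isomorphic_sym.
apply: groupoid_isomorphic_trans univ_pa_groupoid _.
by apply: pa_groupoid_quo_diag => g h x; apply: Wset_coset_inj.
Qed.

End UniversalAction.

Section UniversalMorphism.
Variables (X Y : Type) (C : groupoid X) (G : groupType).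
Variables (theta : partial_action G Y).
Variables (k0 : X -> Y) (k1 : C -> pa_groupoid theta).
Hypothesis kP : groupoid_morphism k0 k1.

Lemma pa_elt_cocycle : cocycle (fun a => pa_elt (k1 a)).
Proof.
have [ks kt _ kc] := kP; move=> a b ab.
have kab : src (k1 a) = tgt (k1 b) by rewrite ks kt ab.
by rewrite (kc _ _ ab kab).
Qed.

Definition functor_lift : univ_group C -> G :=
  univ_lift (fun a => pa_elt (k1 a)).

Lemma functor_liftE a : functor_lift (bracket a) = pa_elt (k1 a).
Proof. exact: (univ_liftE pa_elt_cocycle). Qed.

Lemma functor_lift_morph : monoid_morphism functor_lift.
Proof. exact: univ_lift_morph pa_elt_cocycle. Qed.

Lemma univ_pa_lift : pa_morphism (univ_pa C) theta k0 functor_lift.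
Proof.
have [ks kt _ _] := kP; split; first exact: functor_lift_morph.
- move=> _ _ [_ /univ_domP[a -> ->] <-].
  by rewrite functor_liftE -kt; apply/act_domL/pa_srcP.
- move=> _ _ /univ_domVP[a -> ->].
  by rewrite functor_liftE [act _ _ _]univ_actE -ks -kt.
Qed.

Lemma univ_pa_lift_arrow a : pa_arrow_map univ_pa_lift (bracket_arrow a) = k1 a.
Proof.
have [ks _ _ _] := kP.
by apply: pa_arrow_eq; [apply: functor_liftE|apply/esym/ks].
Qed.

Lemma functor_lift_surj :
  pa_reduced theta -> surjective k1 -> surjective functor_lift.
Proof.
move=> theta_red k1_surj h.
pose brackets := gen_subgroup (range (@bracket X C)).
have /(gen_subgroup_sub_image functor_lift_morph) lift_surj :
    [set g | dom theta g^-1 !=set0] `<=` functor_lift @` brackets.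
  move=> g [y gy]; have [a ka] := k1_surj (PaArrow gy).
  exists (bracket a); first by apply: sub_gen_subgroup; exists a.
  by rewrite functor_liftE ka.
by have [g _ <-] := lift_surj h (theta_red h); exists g.
Qed.

Lemma kernel_functor_lift_Wset :
  injective k1 -> surjective k0 -> Wset C (kernel functor_lift_morph).
Proof.
have [_ _ ku _] := kP; move=> k1_inj k0_surj; apply/WsetP => a.
rewrite /= functor_liftE => ka; apply: bracket_unit.
have [x kx] := k0_surj (pa_src (k1 a)).
by exists x; apply: k1_inj; rewrite ku kx; apply: pa_arrow_eq.
Qed.

End UniversalMorphism.

Lemma reduced_isomorphic_quo (X : Type) (C : groupoid X) (Y : Type)
    (G : groupType) (theta : partial_action G Y) :
  pa_reduced theta -> groupoid_isomorphic (pa_groupoid theta) C ->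
  exists (N : normal_subgroup (univ_group C)) (WN : Wset C N),
    pa_isomorphic theta (quo_pa (Wset_congruence WN)).
Proof.
move=> theta_red [f0 [f1 [k0 [k1 [_ kP [f0K k0K] [f1K k1K]]]]]].
have k0_surj : surjective k0 by move=> y; exists (f0 y).
have k1_surj : surjective k1 by move=> p; exists (f1 p).
exists _, (kernel_functor_lift_Wset (kP := kP) (can_inj k1K) k0_surj).
apply: pa_isomorphic_sym.
apply: (quo_pa_isomorphic (phi_morph := univ_pa_lift kP)).
- by move=> x y; split=> [->|/(can_inj k0K)].
- by [].
- exact: k0_surj.
- exact: (functor_lift_surj kP).
- by move=> p; have [a <-] := k1_surj p; exists (bracket_arrow a);
    apply: univ_pa_lift_arrow.
Qed.

Theorem theorem3p9 (X : Type) (C : groupoid X) (Y : Type) (G : groupType)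
    (theta : partial_action G Y) :
  groupoid_isomorphic (pa_groupoid theta) C <->
  exists (N : normal_subgroup (univ_group C)) (WN : Wset C N),
    pa_isomorphic (red theta) (quo_pa (Wset_congruence WN)).
Proof.
split=> [theta_C|[N [WN red_quo]]].
  apply: reduced_isomorphic_quo (@red_reduced _ _ theta) _.
  exact: groupoid_isomorphic_trans (pa_groupoid_red theta) theta_C.
apply: groupoid_isomorphic_trans (pa_groupoid_quo_univ WN).
apply: groupoid_isomorphic_trans (pa_groupoid_isomorphic red_quo).
exact: groupoid_isomorphic_sym (pa_groupoid_red theta).
Qed.
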